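(* Let $B=(\beta^{(0)},\dots,\beta^{(K)})\in\mathbb{R}^{p\times(K+1)}$ have rank $d<K+1$, let $\Sigma_\varepsilon\in\mathbb{R}^{(K+1)\times(K+1)}$ be a symmetric positive definite matrix, let $e_1=(1,0,\dots,0)^\top\in\mathbb{R}^{K+1}$, and let $$\mathbb W=\{w\in\mathbb{R}^{K+1}:\ Bw=\beta^{(0)}\},\qquad \mathcal P(w)=w^\top\Sigma_\varepsilon w .$$ Let $\nu_1,\dots,\nu_{K+1}$ be orthonormal eigenvectors of $B^\top B$ associated with its eigenvalues $\lambda_1\ge\dots\ge\lambda_{K+1}$, and let $\Theta=(\nu_{d+1},\dots,\nu_{K+1})\in\mathbb{R}^{(K+1)\times(K-d+1)}$. Then $$\mathbb W=\{e_1+\Theta u:\ u\in\mathbb{R}^{K-d+1}\},$$ and the minimizer $w^*=\arg\min_{w\in\mathbb W}\mathcal P(w)$ is given by $$w^*=e_1-\Theta(\Theta^\top\Sigma_\varepsilon\Theta)^{-1}\Theta^\top\Sigma_\varepsilon e_1 .$$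
   Context: Here $\beta^{(0)}$ is the first column of $B$. In the paper $B$ collects the true regression coefficients of a primary task ($k=0$) and $K$ auxiliary tasks, and $\Sigma_\varepsilon$ is the covariance matrix of the vector of the $K+1$ task noises. *)

(* Defs.v *)
From mathcomp Require Import all_boot all_order all_algebra.
From mathcomp Require Import classical_sets reals.
Set Implicit Arguments.
Unset Strict Implicit.
Unset Printing Implicit Defensive.
Import Order.TTheory GRing.Theory Num.Theory.
Local Open Scope ring_scope.
Local Open Scope classical_set_scope.

Definition qform (R : realType) (n : nat) (A : 'M[R]_n) (w : 'cV[R]_n) : R :=
  (w^T *m A *m w) 0 0.

Definition posdefmx (R : realType) (n : nat) (A : 'M[R]_n) : Prop :=
  forall x : 'cV[R]_n, x != 0 -> 0 < qform A x.

Definition is_minimizer (R : realType) (T : Type) (S : set T) (f : T -> R)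
    (x : T) : Prop :=
  S x /\ forall y : T, S y -> f x <= f y.

Definition orthonormal_family (R : realType) (n : nat)
    (nu : 'I_n -> 'cV[R]_n) : Prop :=
  forall i j : 'I_n, ((nu i)^T *m nu j) 0 0 = (i == j)%:R.

(* Columns are indexed from 0: column [ord0] of [B] is beta^(0). *)
Definition weights (R : realType) (p K : nat) (B : 'M[R]_(p, K.+1)) :
    set 'cV[R]_K.+1 :=
  [set w | B *m w = col ord0 B].

(* [nu] is also indexed from 0, so [nu_{d+1}, ..., nu_{K+1}] are the values of
   [nu] at the indices d, ..., K. For d <= K the index [d + j] never exceeds K,
   so [inord] does not default to 0, and [(K - d).+1] equals K - d + 1. *)
Definition tail_eigenmx (R : realType) (K d : nat)
    (nu : 'I_K.+1 -> 'cV[R]_K.+1) : 'M[R]_(K.+1, (K - d).+1) :=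
  \matrix_(i < K.+1, j < (K - d).+1) nu (inord (d + j)) i 0.

(* Main.v *)
Require Import Defs.
From mathcomp Require Import all_boot all_order all_algebra.
From mathcomp Require Import classical_sets reals.
Set Implicit Arguments.
Unset Strict Implicit.
Unset Printing Implicit Defensive.
Import Order.TTheory GRing.Theory Num.Theory.
Local Open Scope ring_scope.
Local Open Scope classical_set_scope.

(** The two claims come from two orthogonality facts.

    Since [B^T *m B *m nu i = lambda i *: nu i] with [nu] orthonormal, the
    vectors [B *m nu i] are pairwise orthogonal with squared norms [lambda i].
    A positive [lambda i] with [i >= d] would, the eigenvalues being
    nonincreasing, make the first [d + 1] of these vectors nonzero, hence
    independent, against [\rank B = d]. So the last eigenvalues vanish
    ([eigen_tail_eq0]) and [B] kills the columns of [Theta]; these columns are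
    orthonormal and there are as many as the dimension of the kernel of [B], so
    they span it ([tail_eigenmx_kernel]). The weights form the translate by [e1]
    of this kernel.

    Minimizing the form of [Sigma] over [e1 + Theta u] is then least squares:
    the proposed [w] satisfies the normal equation [Theta^T *m Sigma *m w = 0],
    so Pythagoras for the inner product given by [Sigma] shows that moving from
    [w] by [Theta *m v] raises the form by its value at [Theta *m v], which is
    positive unless [v = 0] ([affine_minimizerP]). *)

(** * Minimizing a positive definite form on an affine subspace *)

Lemma qform0 (R : realType) n (A : 'M[R]_n) : qform A 0 = 0.
Proof. by rewrite /qform mulmx0 mxE. Qed.

Lemma posdefmx_ge0 (R : realType) n (A : 'M[R]_n) (x : 'cV[R]_n) :
  posdefmx A -> 0 <= qform A x.
Proof.
move=> Apos; have [->|x0] := eqVneq x 0; first by rewrite qform0.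
exact/ltW/Apos.
Qed.

Lemma posdefmx_unit (R : realType) n (A : 'M[R]_n) :
  posdefmx A -> A \in unitmx.
Proof.
move=> Apos; rewrite unitmxE unitfE; apply/negP => /det0P[v v0 vA].
have /Apos : v^T != 0 by rewrite trmx_eq0.
by rewrite /qform trmxK vA mul0mx mxE ltxx.
Qed.

Lemma posdefmx_congr (R : realType) n m (A : 'M[R]_n) (T : 'M[R]_(n, m)) :
  (forall u : 'cV[R]_m, T *m u = 0 -> u = 0) ->
  posdefmx A -> posdefmx (T^T *m A *m T).
Proof.
move=> Tinj Apos x x0.
have /Apos : T *m x != 0 by apply: contraNneq x0 => /Tinj ->.
by rewrite /qform trmx_mul !mulmxA.
Qed.

(** Pythagoras for the inner product defined by [A]; the symmetry of [A] makes
    both cross terms the same. *)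
Lemma qformD_orth (R : realType) n (A : 'M[R]_n) (x y : 'cV[R]_n) :
  A^T = A -> y^T *m A *m x = 0 -> qform A (x + y) = qform A x + qform A y.
Proof.
move=> Asym yAx; have xAy : x^T *m A *m y = 0.
  by apply: trmx_inj; rewrite !trmx_mul trmxK Asym trmx0 mulmxA.
by rewrite /qform [(x + y)^T]raddfD /= !mulmxDl !mulmxDr xAy yAx addr0 add0r mxE.
Qed.

Lemma affine_minimizerP (R : realType) n m (A : 'M[R]_n) (T : 'M[R]_(n, m))
    (a w : 'cV[R]_n) :
  A^T = A -> posdefmx A -> (forall u : 'cV[R]_m, T *m u = 0 -> u = 0) ->
  is_minimizer [set a + T *m u | u in [set: 'cV[R]_m]] (qform A) w <->
  w = a - T *m invmx (T^T *m A *m T) *m T^T *m A *m a.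
Proof.
move=> Asym Apos Tinj; set M := T^T *m A *m T.
have Munit : M \in unitmx by apply/posdefmx_unit/posdefmx_congr.
set u0 : 'cV[R]_m := - (invmx M *m T^T *m A *m a).
have -> : a - T *m invmx M *m T^T *m A *m a = a + T *m u0.
  by rewrite /u0 mulmxN !mulmxA.
set w0 := a + T *m u0.
have normal : T^T *m A *m w0 = 0.
  by rewrite mulmxDr !mulmxA -/M /u0 mulmxN !mulmxA mulmxV // mul1mx subrr.
have pythagoras u : qform A (a + T *m u)
    = qform A w0 + qform A (T *m (u - u0)).
  rewrite -qformD_orth //; last first.
    by rewrite trmx_mul -!mulmxA (mulmxA T^T) normal mulmx0.
  by rewrite /w0 -addrA -mulmxDr subrKC.
split=> [[[u _ <-] umin]|->].
  have := umin w0 (ex_intro2 _ _ u0 I erefl).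
  rewrite pythagoras gerDl leNgt => /negP noincr; congr (_ + _ *m _).
  apply/eqP; rewrite -subr_eq0; apply/eqP/Tinj/eqP.
  by apply: contra_notT noincr => /Apos.
split; first by exists u0.
by move=> _ [u _ <-]; rewrite pythagoras lerDl posdefmx_ge0.
Qed.

(** * The kernel of a matrix from the eigenvectors of its Gram matrix *)

Lemma orthonormal_cols (R : realType) n m (nu : 'I_n -> 'cV[R]_n)
    (f : 'I_m -> 'I_n) :
  injective f -> orthonormal_family nu ->
  let N := \matrix_(i < n, j < m) nu (f j) i 0 in N^T *m N = 1%:M.
Proof.
move=> finj nu1 N; apply/matrixP => i j.
rewrite !mxE -(inj_eq finj) -nu1 mxE.
by apply: eq_bigr => k _; rewrite !mxE.
Qed.

(** The Rayleigh quotient of an eigenvector of the Gram matrix of [B], with the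
    squared norm written as a sum of squares, so that its sign and its vanishing
    can be read off. *)
Lemma eigen_sqnorm (R : realType) p n (B : 'M[R]_(p, n)) (lambda : 'I_n -> R)
    (nu : 'I_n -> 'cV[R]_n) (i : 'I_n) :
  orthonormal_family nu ->
  (forall i, B^T *m B *m nu i = lambda i *: nu i) ->
  lambda i = \sum_k (B *m nu i) k 0 ^+ 2.
Proof.
move=> nu1 nuE.
have : ((nu i)^T *m (B^T *m B *m nu i)) 0 0 = lambda i.
  by rewrite nuE -scalemxAr mxE nu1 eqxx mulr1.
move=> <-; rewrite !mulmxA -trmx_mul -mulmxA mxE.
by apply: eq_bigr => k _; rewrite mxE.
Qed.

(** Were [lambda i] positive, so would be all the eigenvalues of index at most
    [i], and their eigenvectors would have [i + 1] independent images. *)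
Lemma eigen_tail_eq0 (R : realType) p n (B : 'M[R]_(p, n))
    (lambda : 'I_n -> R) (nu : 'I_n -> 'cV[R]_n) (i : 'I_n) :
  (forall i j : 'I_n, (i <= j)%N -> lambda j <= lambda i) ->
  orthonormal_family nu ->
  (forall i, B^T *m B *m nu i = lambda i *: nu i) ->
  (\rank B <= i)%N -> lambda i = 0.
Proof.
move=> lambda_noninc nu1 nuE rank_le.
have : 0 <= lambda i.
  by rewrite (eigen_sqnorm i nu1 nuE) sumr_ge0 // => k _; apply: sqr_ge0.
rewrite le_eqVlt => /predU1P[<- //|li_gt0]; exfalso.
pose f : 'I_i.+1 -> 'I_n := widen_ord (ltn_ord i).
have finj : injective f by move=> j k /(congr1 val) /= /val_inj.
pose N := \matrix_(k < n, j < i.+1) nu (f j) k 0.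
pose D := \row_(j < i.+1) lambda (f j).
(* The Gram matrix of the first [i + 1] vectors [B *m nu j] is diagonal with
   positive entries, hence of rank [i + 1]. *)
have gram : (B *m N)^T *m (B *m N) = diag_mx D.
  have BBN : B^T *m B *m N = N *m diag_mx D.
    apply/matrixP => k j; rewrite mul_mx_diag !mxE mulrC.
    move/matrixP/(_ k 0): (nuE (f j)); rewrite [in RHS]mxE => <-.
    by rewrite [in RHS]mxE; apply: eq_bigr => l _; rewrite [N _ _]mxE.
  by rewrite trmx_mul -mulmxA (mulmxA B^T) BBN mulmxA orthonormal_cols ?mul1mx.
have Dunit : diag_mx D \in unitmx.
  rewrite unitmxE unitfE det_diag; apply/prodf_neq0 => j _; rewrite mxE.
  by apply/lt0r_neq0/(lt_le_trans li_gt0)/lambda_noninc; rewrite /= -ltnS.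
have : (i.+1 <= \rank B)%N.
  rewrite -(mxrank_unit Dunit) -gram.
  by apply: leq_trans (mxrankM_maxr _ _) (mxrankM_maxl _ _).
by rewrite ltnNge rank_le.
Qed.

Lemma tail_index_lt K d (j : 'I_(K - d).+1) : (d < K.+1)%N -> (d + j < K.+1)%N.
Proof. by move=> d_lt; rewrite ltnS -leq_subRL // -ltnS. Qed.

Lemma tail_index_inj K d : (d < K.+1)%N ->
  injective (fun j : 'I_(K - d).+1 => inord (d + j) : 'I_K.+1).
Proof.
move=> d_lt j k /(congr1 val) /=.
by rewrite !inordK ?tail_index_lt // => /addnI /val_inj.
Qed.

Lemma tail_eigenmx_orthonormal (R : realType) K d
    (nu : 'I_K.+1 -> 'cV[R]_K.+1) :
  (d < K.+1)%N -> orthonormal_family nu ->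
  (tail_eigenmx d nu)^T *m tail_eigenmx d nu = 1%:M.
Proof. by move=> d_lt; apply/orthonormal_cols/tail_index_inj. Qed.

(** The inclusion of the span of the tail in the kernel is [eigen_tail_eq0]; it
    is an equality because both spaces have dimension [K.+1 - d]. *)
Lemma tail_eigenmx_kernel (R : realType) p K d (B : 'M[R]_(p, K.+1))
    (lambda : 'I_K.+1 -> R) (nu : 'I_K.+1 -> 'cV[R]_K.+1) (x : 'cV[R]_K.+1) :
  \rank B = d -> (d < K.+1)%N ->
  (forall i j : 'I_K.+1, (i <= j)%N -> lambda j <= lambda i) ->
  orthonormal_family nu ->
  (forall i, B^T *m B *m nu i = lambda i *: nu i) ->
  B *m x = 0 <-> exists u, x = tail_eigenmx d nu *m u.
Proof.
move=> rankB d_lt lambda_noninc nu1 nuE; set Theta := tail_eigenmx d nu.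
have ThetaK : Theta^T *m Theta = 1%:M by apply: tail_eigenmx_orthonormal.
have BTheta : B *m Theta = 0.
  apply/matrixP => k j; rewrite [RHS]mxE; set i : 'I_K.+1 := inord (d + j).
  have li0 : lambda i = 0.
    apply: (eigen_tail_eq0 lambda_noninc nu1 nuE).
    by rewrite rankB inordK ?leq_addr ?tail_index_lt.
  (* A vanishing eigenvalue is a vanishing sum of squares. *)
  have := eigen_sqnorm i nu1 nuE; rewrite li0 => /esym/eqP.
  rewrite psumr_eq0 => [/allP/(_ k (mem_index_enum k))|l _]; last exact: sqr_ge0.
  rewrite /= sqrf_eq0 => /eqP <-.
  by rewrite !mxE; apply: eq_bigr => l _; rewrite mxE.
split=> [Bx0|[u ->]]; last by rewrite mulmxA BTheta mul0mx.
(* Row spaces being the primitive notion, compare the kernel with [Theta]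
   after transposition. *)
have sub : (Theta^T <= kermx B^T)%MS.
  by apply/sub_kermxP; rewrite -trmx_mul BTheta trmx0.
have rank_Theta : \rank Theta^T = (K - d).+1.
  apply/eqP; rewrite eqn_leq rank_leq_row /=.
  by rewrite -[X in (X <= _)%N](mxrank1 R) -ThetaK mxrankM_maxl.
have span : (kermx B^T <= Theta^T)%MS.
  rewrite -(geq_leqif (mxrank_leqif_sup sub)) rank_Theta mxrank_ker.
  by rewrite mxrank_tr rankB subSn.
have /submxP[v xv] : (x^T <= Theta^T)%MS.
  by apply: submx_trans span; apply/sub_kermxP; rewrite -trmx_mul Bx0 trmx0.
by exists v^T; apply: trmx_inj; rewrite trmx_mul trmxK.
Qed.

(** * The optimal weights *)

Theorem mainTheorem3 (R : realType) (p K d : nat)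
    (B : 'M[R]_(p, K.+1)) (Sigma : 'M[R]_K.+1)
    (lambda : 'I_K.+1 -> R) (nu : 'I_K.+1 -> 'cV[R]_K.+1)
    (rankB : \rank B = d) (d_lt : (d < K.+1)%N)
    (Sigma_sym : Sigma^T = Sigma) (Sigma_pos : posdefmx Sigma)
    (lambda_noninc : forall i j : 'I_K.+1, (i <= j)%N -> lambda j <= lambda i)
    (nu_orthonormal : orthonormal_family nu)
    (nu_eigen : forall i : 'I_K.+1, B^T *m B *m nu i = lambda i *: nu i) :
  let e1 : 'cV[R]_K.+1 := delta_mx ord0 0 in
  let Theta : 'M[R]_(K.+1, (K - d).+1) := tail_eigenmx d nu in
  weights B = [set e1 + Theta *m u | u in [set: 'cV[R]_(K - d).+1]] /\
  Theta^T *m Sigma *m Theta \in unitmx /\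
  (forall w : 'cV[R]_K.+1,
    is_minimizer (weights B) (qform Sigma) w <->
    w = e1 - Theta *m invmx (Theta^T *m Sigma *m Theta)
               *m Theta^T *m Sigma *m e1).
Proof.
move=> e1 Theta.
have ThetaK : Theta^T *m Theta = 1%:M by apply: tail_eigenmx_orthonormal.
have Theta_inj (u : 'cV[R]_(K - d).+1) : Theta *m u = 0 -> u = 0.
  by move=> Tu0; rewrite -[u]mul1mx -ThetaK -mulmxA Tu0 mulmx0.
have kerB x := tail_eigenmx_kernel x rankB d_lt lambda_noninc nu_orthonormal
  nu_eigen.
have weightsE :
    weights B = [set e1 + Theta *m u | u in [set: 'cV[R]_(K - d).+1]].
  have Be1 : B *m e1 = col ord0 B by rewrite -colE.
  apply/seteqP; split=> [w Bw|_ [u _ <-]].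
    have [|u wu] := (kerB (w - e1)).1; first by rewrite mulmxBr Bw Be1 subrr.
    by exists u => //; rewrite -wu subrKC.
  rewrite /weights /= mulmxDr Be1; have -> : B *m (Theta *m u) = 0.
    by apply/kerB; exists u.
  exact: addr0.
split; first exact: weightsE.
split; first exact/posdefmx_unit/posdefmx_congr.
by move=> w; rewrite weightsE; apply: affine_minimizerP.
Qed.
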